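(* Let $K$ be a field and let $E$ be a row-finite directed graph (no vertex emits infinitely many edges). Up to graded isomorphism, all finite-dimensional graded simple $L_K(E)$-modules are the modules $V_{[x]}(n)$, where $n\in\mathbb Z$ and $x$ is a maximal sink with finitely many predecessors.
   Context: $E=(E^0,E^1,s,r)$ is a directed graph of arbitrary cardinality. A sink is a vertex emitting no edges. A finite path is $\mu=e_1\cdots e_n$ with $r(e_i)=s(e_{i+1})$, length $|\mu|=n$, $s(\mu)=s(e_1)$, $r(\mu)=r(e_n)$; vertices are paths of length $0$; $F(E)$ is the set of finite paths. A closed path is a path $\mu$ of positive length with $s(\mu)=r(\mu)$; a cycle is a closed path not passing through any of its vertices twice. The predecessors of a sink $v$ are the vertices $w$ such that there is a finite path from $w$ to $v$. A sink $v$ is maximal if there is no finite path from $s(c')$ to $v$ for any cycle $c'$. $L_K(E)$ is the Leavitt path algebra: the $K$-algebra generated by $\{v,e,e^*\mid v\in E^0,e\in E^1\}$ with relations $vw=\delta_{v,w}v$; $s(e)e=e=er(e)$; $r(e)e^*=e^*=e^*s(e)$; $e^*f=\delta_{e,f}r(e)$; $v=\sum_{s(e)=v}ee^*$ for each $v$ emitting a nonzero finite number of edges. It is spanned by $\mu\nu^*$ ($\mu,\nu\in F(E)$, $r(\mu)=r(\nu)$) and is $\mathbb Z$-graded with $\mu\nu^*$ of degree $|\mu|-|\nu|$. Modules are left and unital ($AM=M$); graded simple means nonzero with no proper nonzero graded submodules. The shift $M(n)$ is given by $M(n)_k=M_{k+n}$. For a sink $x$, $[x]$ is the set of all finite paths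 ending at $x$ and $V_{[x]}$ is the $K$-vector space with basis $[x]$ and action $(\mu\nu^* ).p=\mu p'$ if $p=\nu p'$, and $0$ otherwise; it is $\mathbb Z$-graded with $p\in[x]$ of degree $|p|$. *)

(* Defs.v *)
From HB Require Import structures.
From mathcomp Require Import all_boot all_order all_algebra.
From mathcomp Require Import boolp classical_sets cardinality.
From mathcomp Require Import finmap monalg.

Set Implicit Arguments.
Unset Strict Implicit.
Unset Printing Implicit Defensive.

Import GRing.Theory.

Local Open Scope quotient_scope.
Local Open Scope classical_set_scope.
Local Open Scope ring_scope.

Record digraph := Digraph {
  vert : Type;
  edge : Type;
  src : edge -> vert;
  rng : edge -> vert
}.

(* Classical instances, so that the vertex and edge types stay arbitrary. *)
HB.instance Definition _ (E : digraph) := gen_eqMixin (vert E).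
HB.instance Definition _ (E : digraph) := gen_choiceMixin (vert E).
HB.instance Definition _ (E : digraph) := gen_eqMixin (edge E).
HB.instance Definition _ (E : digraph) := gen_choiceMixin (edge E).

Section Graph.
Variable E : digraph.

Definition row_finite := forall v : vert E, finite_set [set e | src e = v].

Fixpoint is_walk (v : vert E) (s : seq (edge E)) : bool :=
  if s is e :: s' then (src e == v) && is_walk (rng e) s' else true.

(* A finite path is its source together with its edges; the source is needed
   to tell apart the paths of length 0. *)
Record fpath := FPath {
  pval : vert E * seq (edge E);
  _ : is_walk pval.1 pval.2
}.
HB.instance Definition _ := [isSub for pval].
HB.instance Definition _ := [Choice of fpath by <:].

Definition psrc (p : fpath) : vert E := (pval p).1.
Definition pedges (p : fpath) : seq (edge E) := (pval p).2.
Definition plen (p : fpath) : nat := size (pedges p).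
Definition raw_rng (q : vert E * seq (edge E)) : vert E :=
  last q.1 (map (@rng E) q.2).
Definition prng (p : fpath) : vert E := raw_rng (pval p).

(* p is the concatenation of mu and nu. *)
Definition pcat_spec (mu nu p : fpath) : Prop :=
  [/\ prng mu = psrc nu, psrc p = psrc mu & pedges p = pedges mu ++ pedges nu].

Definition closed_path (p : fpath) : Prop :=
  (0 < plen p)%N /\ psrc p = prng p.

Definition is_cycle (p : fpath) : Prop :=
  closed_path p /\ uniq (map (@src E) (pedges p)).

Definition connects (v w : vert E) : Prop :=
  exists p : fpath, psrc p = v /\ prng p = w.

Definition is_sink (v : vert E) : Prop := forall e : edge E, src e <> v.

Definition predecessors (v : vert E) : set (vert E) := [set w | connects w v].

Definition maximal_sink (v : vert E) : Prop :=
  is_sink v /\ forall c : fpath, is_cycle c -> ~ connects (psrc c) v.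

Definition paths_to (x : vert E) := {p : fpath | prng p == x}.
HB.instance Definition _ x := Choice.on (paths_to x).

End Graph.

(* The Leavitt path algebra: formal K-algebra expressions in the generators,
   modulo the least congruence containing the axioms of associative, not
   necessarily unital, K-algebras and the defining relations. *)
Section LeavittDef.
Variables (K : fieldType) (E : digraph).

Inductive lterm : Type :=
| TVert of vert E
| TEdge of edge E
| TGhost of edge E
| TZero
| TAdd of lterm & lterm
| TScale of K & lterm
| TMul of lterm & lterm.

Inductive lrel : lterm -> lterm -> Prop :=
| lrel_refl a : lrel a a
| lrel_sym a b : lrel a b -> lrel b a
| lrel_trans a b c : lrel a b -> lrel b c -> lrel a c
| lrel_addc a a' b b' : lrel a a' -> lrel b b' -> lrel (TAdd a b) (TAdd a' b')
| lrel_scalec k a a' : lrel a a' -> lrel (TScale k a) (TScale k a')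
| lrel_mulc a a' b b' : lrel a a' -> lrel b b' -> lrel (TMul a b) (TMul a' b')
| lrel_addA a b c : lrel (TAdd a (TAdd b c)) (TAdd (TAdd a b) c)
| lrel_addC a b : lrel (TAdd a b) (TAdd b a)
| lrel_add0 a : lrel (TAdd TZero a) a
| lrel_addN a : lrel (TAdd (TScale (-1) a) a) TZero
| lrel_scaleA k l a : lrel (TScale k (TScale l a)) (TScale (k * l) a)
| lrel_scale1 a : lrel (TScale 1 a) a
| lrel_scaleDr k a b : lrel (TScale k (TAdd a b)) (TAdd (TScale k a) (TScale k b))
| lrel_scaleDl k l a : lrel (TScale (k + l) a) (TAdd (TScale k a) (TScale l a))
| lrel_mulA a b c : lrel (TMul a (TMul b c)) (TMul (TMul a b) c)
| lrel_mulDl a b c : lrel (TMul (TAdd a b) c) (TAdd (TMul a c) (TMul b c))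
| lrel_mulDr a b c : lrel (TMul a (TAdd b c)) (TAdd (TMul a b) (TMul a c))
| lrel_mulZl k a b : lrel (TMul (TScale k a) b) (TScale k (TMul a b))
| lrel_mulZr k a b : lrel (TMul a (TScale k b)) (TScale k (TMul a b))
| lrel_vert v w :
    lrel (TMul (TVert v) (TVert w)) (if v == w then TVert v else TZero)
| lrel_src_edge e : lrel (TMul (TVert (src e)) (TEdge e)) (TEdge e)
| lrel_edge_rng e : lrel (TMul (TEdge e) (TVert (rng e))) (TEdge e)
| lrel_rng_ghost e : lrel (TMul (TVert (rng e)) (TGhost e)) (TGhost e)
| lrel_ghost_src e : lrel (TMul (TGhost e) (TVert (src e))) (TGhost e)
| lrel_ghost_edge e f :
    lrel (TMul (TGhost e) (TEdge f)) (if e == f then TVert (rng e) else TZero)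
(* v = sum of the e e^* over the edges e emitted by v, when these are finitely
   many (listed without repetition by s) and at least one *)
| lrel_regular v (s : seq (edge E)) :
    s <> [::] -> uniq s -> (forall e, e \in s <-> src e = v) ->
    lrel (TVert v)
        (foldr (fun e t => TAdd (TMul (TEdge e) (TGhost e)) t) TZero s).

HB.instance Definition _ := gen_eqMixin lterm.
HB.instance Definition _ := gen_choiceMixin lterm.

Definition lrelb (a b : lterm) : bool := `[< lrel a b >].

Lemma lrelb_refl : reflexive lrelb.
Proof. by move=> a; apply/asboolP; exact: lrel_refl. Qed.

Lemma lrelb_sym : symmetric lrelb.
Proof.
by move=> a b; apply/asboolP/asboolP; exact: lrel_sym.
Qed.

Lemma lrelb_trans : transitive lrelb.
Proof.
by move=> b a c /asboolP ab /asboolP bc; apply/asboolP; exact: lrel_trans ab bc.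
Qed.

Canonical lrelb_equiv := EquivRel lrelb lrelb_refl lrelb_sym lrelb_trans.

Definition leavitt := {eq_quot lrelb_equiv}.
HB.instance Definition _ := Choice.on leavitt.
HB.instance Definition _ := EqQuotient.on leavitt.

Definition cls (t : lterm) : leavitt := \pi_leavitt t.

Lemma clsP (s t : lterm) : lrel s t <-> cls s = cls t.
Proof.
split=> [st|/eqmodP/asboolP //].
by apply/eqmodP/asboolP.
Qed.

Lemma repr_cls (t : lterm) : lrel (repr (cls t)) t.
Proof. by apply/clsP; rewrite /cls reprK. Qed.

Lemma cls_repr (a : leavitt) : cls (repr a) = a.
Proof. exact: reprK. Qed.

Lemma cls_ind (P : leavitt -> Prop) : (forall t, P (cls t)) -> forall a, P a.
Proof. by move=> H a; rewrite -(cls_repr a). Qed.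

Definition ladd (a b : leavitt) : leavitt := cls (TAdd (repr a) (repr b)).
Definition lscale (k : K) (a : leavitt) : leavitt := cls (TScale k (repr a)).
Definition lopp (a : leavitt) : leavitt := lscale (-1) a.
Definition lmul (a b : leavitt) : leavitt := cls (TMul (repr a) (repr b)).

Lemma laddE s t : ladd (cls s) (cls t) = cls (TAdd s t).
Proof. by apply/clsP; apply: lrel_addc; exact: repr_cls. Qed.
Lemma lscaleE k t : lscale k (cls t) = cls (TScale k t).
Proof. by apply/clsP; apply: lrel_scalec; exact: repr_cls. Qed.
Lemma lmulE s t : lmul (cls s) (cls t) = cls (TMul s t).
Proof. by apply/clsP; apply: lrel_mulc; exact: repr_cls. Qed.

Fact laddA : associative ladd.
Proof.
elim/cls_ind=> a; elim/cls_ind=> b; elim/cls_ind=> c.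
by rewrite !laddE; apply/clsP; exact: lrel_addA.
Qed.
Fact laddC : commutative ladd.
Proof.
elim/cls_ind=> a; elim/cls_ind=> b.
by rewrite !laddE; apply/clsP; exact: lrel_addC.
Qed.
Fact ladd0 : left_id (cls TZero) ladd.
Proof. by elim/cls_ind=> a; rewrite laddE; apply/clsP; exact: lrel_add0. Qed.
Fact laddN : left_inverse (cls TZero) lopp ladd.
Proof.
elim/cls_ind=> a; rewrite /lopp lscaleE laddE.
by apply/clsP; exact: lrel_addN.
Qed.

HB.instance Definition _ :=
  GRing.isZmodule.Build leavitt laddA laddC ladd0 laddN.

Fact lscaleA k l a : lscale k (lscale l a) = lscale (k * l) a.
Proof.
by elim/cls_ind: a => a; rewrite !lscaleE; apply/clsP; exact: lrel_scaleA.
Qed.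
Fact lscale1 : left_id 1 lscale.
Proof. by elim/cls_ind=> a; rewrite lscaleE; apply/clsP; exact: lrel_scale1. Qed.
Fact lscaleDr : right_distributive lscale +%R.
Proof.
move=> k; elim/cls_ind=> a; elim/cls_ind=> b.
rewrite [cls a + _]laddE !lscaleE [RHS]laddE.
by apply/clsP; exact: lrel_scaleDr.
Qed.
Fact lscaleDl a : {morph lscale^~ a : k l / k + l}.
Proof.
elim/cls_ind: a => a k l; rewrite !lscaleE [RHS]laddE.
by apply/clsP; exact: lrel_scaleDl.
Qed.

HB.instance Definition _ :=
  GRing.Zmodule_isLmodule.Build K leavitt lscaleA lscale1 lscaleDr lscaleDl.

Lemma lmulA : associative lmul.
Proof.
elim/cls_ind=> a; elim/cls_ind=> b; elim/cls_ind=> c.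
by rewrite !lmulE; apply/clsP; exact: lrel_mulA.
Qed.
Lemma lmulDl : left_distributive lmul +%R.
Proof.
elim/cls_ind=> a; elim/cls_ind=> b; elim/cls_ind=> c.
rewrite [cls a + _]laddE !lmulE [RHS]laddE.
by apply/clsP; exact: lrel_mulDl.
Qed.
Lemma lmulDr : right_distributive lmul +%R.
Proof.
elim/cls_ind=> a; elim/cls_ind=> b; elim/cls_ind=> c.
rewrite [cls b + _]laddE !lmulE [RHS]laddE.
by apply/clsP; exact: lrel_mulDr.
Qed.
Lemma lmulZl (k : K) a b : lmul (k *: a) b = k *: lmul a b.
Proof.
elim/cls_ind: a => a; elim/cls_ind: b => b.
rewrite [k *: _]lscaleE !lmulE [RHS]lscaleE.
by apply/clsP; exact: lrel_mulZl.
Qed.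
Lemma lmulZr (k : K) a b : lmul a (k *: b) = k *: lmul a b.
Proof.
elim/cls_ind: a => a; elim/cls_ind: b => b.
rewrite [k *: _]lscaleE !lmulE [RHS]lscaleE.
by apply/clsP; exact: lrel_mulZr.
Qed.

Definition lvert (v : vert E) : leavitt := cls (TVert v).
Definition ledge (e : edge E) : leavitt := cls (TEdge e).
Definition lghost (e : edge E) : leavitt := cls (TGhost e).

(* The path e_1 ... e_n, as the product s(mu) e_1 ... e_n, and its ghost
   e_n^* ... e_1^* s(mu). *)
Definition lpath (mu : fpath E) : leavitt :=
  foldl (fun a e => lmul a (ledge e)) (lvert (psrc mu)) (pedges mu).
Definition lpath_ghost (nu : fpath E) : leavitt :=
  foldl (fun a e => lmul (lghost e) a) (lvert (psrc nu)) (pedges nu).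

(* mu nu^* *)
Definition lmono (mu nu : fpath E) : leavitt := lmul (lpath mu) (lpath_ghost nu).

Definition ldeg (k : int) : set leavitt :=
  [set a | exists (n : nat) (c : 'I_n -> K) (mu nu : 'I_n -> fpath E),
     (forall i, prng (mu i) = prng (nu i) /\
                (plen (mu i))%:Z - (plen (nu i))%:Z = k) /\
     a = \sum_(i < n) c i *: lmono (mu i) (nu i)].

End LeavittDef.

Arguments TVert {K E} v.
Arguments TEdge {K E} e.
Arguments TGhost {K E} e.
Arguments TZero {K E}.

Section Modules.
Variables (K : fieldType) (E : digraph).

Record lmodule := LModule {
  lmod_space :> lmodType K;
  lact : leavitt K E -> lmod_space -> lmod_space;
  lact_linear : forall a, linear (lact a);
  lact_linearl : forall m, linear (lact^~ m);
  lactA : forall a b m, lact (lmul a b) m = lact a (lact b m);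
  lact_unital : forall m, exists (n : nat) (a : 'I_n -> leavitt K E)
    (y : 'I_n -> lmod_space), m = \sum_(i < n) lact (a i) (y i)
}.

Definition is_subspace (V : lmodType K) (U : set V) : Prop :=
  U 0 /\ forall (k : K) (u w : V), U u -> U w -> U (k *: u + w).

Definition direct_sum (V : lmodType K) (H : int -> set V) : Prop :=
  [/\ forall k, is_subspace (H k),
      forall m, exists (s : seq int) (f : int -> V),
        (forall k, H k (f k)) /\ m = \sum_(k <- s) f k
    & forall (s : seq int) (f : int -> V), uniq s -> (forall k, H k (f k)) ->
        \sum_(k <- s) f k = 0 -> forall k, k \in s -> f k = 0].

Record grmodule := GrModule {
  gr_mod :> lmodule;
  gr_part : int -> set gr_mod;
  gr_direct : direct_sum gr_part;
  gr_act : forall (k l : int) a m,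
    ldeg k a -> gr_part l m -> gr_part (k + l) (lact a m)
}.

Definition is_submodule (M : lmodule) (N : set M) : Prop :=
  is_subspace N /\ forall a m, N m -> N (lact a m).

Definition is_graded_submodule (M : grmodule) (N : set M) : Prop :=
  is_submodule N /\
  forall m, N m -> exists (s : seq int) (f : int -> M),
    (forall k, N (f k) /\ gr_part k (f k)) /\ m = \sum_(k <- s) f k.

Definition graded_simple (M : grmodule) : Prop :=
  (exists m : M, m <> 0) /\
  forall N : set M, is_graded_submodule N -> N = [set 0] \/ N = setT.

Definition finite_dim (V : lmodType K) : Prop :=
  exists (n : nat) (b : 'I_n -> V),
    forall m, exists c : 'I_n -> K, m = \sum_(i < n) c i *: b i.

Definition gr_isomorphic (M N : grmodule) : Prop :=
  exists f : M -> N,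
    [/\ linear f, bijective f, forall a m, f (lact a m) = lact a (f m)
      & forall k m, gr_part k m -> gr_part k (f m)].

Section Shift.
Variables (M : grmodule) (n : int).

Definition shift_part (k : int) : set M := gr_part (k + n).

Lemma shift_direct : direct_sum shift_part.
Proof.
have [Hs Hd Hi] := gr_direct M; split.
- by move=> k; exact: Hs.
- move=> m; have [s [f [Hf ->]]] := Hd m.
  exists [seq k - n | k <- s], (fun k => f (k + n)); split.
    by move=> k; exact: Hf.
  by rewrite big_map; apply: eq_bigr => k _; rewrite subrK.
- move=> s f us Hf Hsum k ks.
  rewrite -(addrK n k).
  apply: (Hi [seq k + n | k <- s] (fun k => f (k - n))).
  + by rewrite map_inj_uniq //; exact: addIr.
  + by move=> j; have := Hf (j - n); rewrite /shift_part subrK.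
  + by rewrite big_map -[RHS]Hsum; apply: eq_bigr => j _; rewrite addrK.
  + exact: map_f.
Qed.

Lemma shift_act (k l : int) a m :
  ldeg k a -> shift_part l m -> shift_part (k + l) (lact a m).
Proof. by move=> Ha Hm; rewrite /shift_part -addrA; exact: gr_act. Qed.

Definition grshift : grmodule := GrModule shift_direct shift_act.

End Shift.
End Modules.

Section LinearExtension.
Variables (K : fieldType) (B : choiceType) (W : lmodType K) (h : B -> W).

Definition lin_ext (m : {malg K[B]}) : W := \sum_(b <- msupp m) m@_b *: h b.

Lemma lin_extEw (d : {fset B}) (m : {malg K[B]}) : (msupp m `<=` d)%fset ->
  lin_ext m = \sum_(b <- d) m@_b *: h b.
Proof.
move=> le_d; rewrite /lin_ext.
rewrite (big_fset_incl _ le_d) // => b _ /mcoeff_outdom ->.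
by rewrite scale0r.
Qed.

Lemma lin_ext_linear : linear lin_ext.
Proof.
move=> k m n.
pose d := (msupp (k *: m + n) `|` (msupp m `|` msupp n))%fset.
rewrite !(@lin_extEw d).
- rewrite scaler_sumr -big_split /=; apply: eq_bigr => b _.
  by rewrite mcoeffD mcoeffZ scalerDl scalerA.
- by apply/fsubsetP => b hb; rewrite !inE hb !orbT.
- by apply/fsubsetP => b hb; rewrite !inE hb !orbT.
- by apply/fsubsetP => b hb; rewrite !inE hb.
Qed.

Lemma lin_extU b : lin_ext << b >> = h b.
Proof. by rewrite /lin_ext msuppU oner_eq0 big_seq_fset1 mcoeffUU scale1r. Qed.

Lemma malgUZ (c : K) (b : B) : << c *g b >> = c *: << b >> :> {malg K[B]}.
Proof. by apply/malgP => b'; rewrite mcoeffZ !mcoeffU mulrnAr mulr1. Qed.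

Lemma malg_basis (m : ({malg K[B]} : lmodType K)) :
  m = \sum_(b <- msupp m) m@_b *: << b >>.
Proof. by rewrite {1}(monalgE m); under eq_bigr do rewrite malgUZ. Qed.

End LinearExtension.

(* V_[x], for a sink x.  The generators act on the basis [x] by
   v.p = p if s(p) = v,  e.p = ep if r(e) = s(p),  e^*.(ep') = p',
   and by 0 otherwise; [Vact_mono] and [Vact_mono0] below are the formulas for
   the action of an arbitrary mu nu^*. *)
Section SinkModule.
Variables (K : fieldType) (E : digraph) (x : vert E).

Local Notation Vspace := {malg K[paths_to x]}.

(* The basis vector of a path given by its source and edges (0 if these are
   not the data of a path ending at x). *)
Definition bvec (q : vert E * seq (edge E)) : Vspace :=
  if (insub q : option (fpath E)) is Some p then
    if (insub p : option (paths_to x)) is Some p' then << p' >> else 0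
  else 0.

Definition bvalid (q : vert E * seq (edge E)) : Prop :=
  is_walk q.1 q.2 /\ raw_rng q = x.

Lemma bvec_val (p : paths_to x) : bvec (pval (val p)) = << p >>.
Proof. by rewrite /bvec valK valK. Qed.

Lemma bvalid_val (p : paths_to x) : bvalid (pval (val p)).
Proof. by case: p => -[q qw] /= /eqP qx. Qed.

Lemma bvalidP q : bvalid q -> exists p : paths_to x, pval (val p) = q.
Proof.
move=> [qw /eqP qx].
by exists (exist _ (@FPath E q qw) qx : paths_to x).
Qed.

Definition vert_img (v : vert E) (p : paths_to x) : Vspace :=
  if psrc (val p) == v then << p >> else 0.
Definition edge_img (e : edge E) (p : paths_to x) : Vspace :=
  if rng e == psrc (val p) then bvec (src e, e :: pedges (val p)) else 0.
Definition ghost_img (e : edge E) (p : paths_to x) : Vspace :=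
  if pedges (val p) is f :: s then if f == e then bvec (rng e, s) else 0 else 0.

Fixpoint Vterm (t : lterm K E) : Vspace -> Vspace :=
  match t with
  | TVert v => lin_ext (vert_img v)
  | TEdge e => lin_ext (edge_img e)
  | TGhost e => lin_ext (ghost_img e)
  | TZero => fun _ => 0
  | TAdd a b => fun m => Vterm a m + Vterm b m
  | TScale k a => fun m => k *: Vterm a m
  | TMul a b => fun m => Vterm a (Vterm b m)
  end.

Lemma Vterm_linear t : linear (Vterm t).
Proof.
elim: t => [v|e|e||a IHa b IHb|k a IHa|a IHa b IHb] c m n /=;
  try exact: lin_ext_linear.
- by rewrite scaler0 addr0.
- by rewrite IHa IHb scalerDr addrACA.
- by rewrite IHa scalerDr !scalerA mulrC.
- by rewrite IHb IHa.
Qed.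

HB.instance Definition _ t :=
  GRing.isLinear.Build K Vspace Vspace *:%R (Vterm t) (Vterm_linear t).

Lemma linear_extP (f g : {linear Vspace -> Vspace}) :
  (forall q, bvalid q -> f (bvec q) = g (bvec q)) -> f =1 g.
Proof.
move=> fg m; rewrite (monalgE m) !linear_sum; apply: eq_bigr => p _ /=.
by rewrite malgUZ -bvec_val !linearZ /= fg //; exact: bvalid_val.
Qed.

Lemma Vterm_ext a b :
  (forall q, bvalid q -> Vterm a (bvec q) = Vterm b (bvec q)) ->
  Vterm a =1 Vterm b.
Proof. exact: linear_extP. Qed.

Lemma VtermM a b m : Vterm (TMul a b) m = Vterm a (Vterm b m).
Proof. by []. Qed.

Lemma Vterm_vert v w s : bvalid (w, s) ->
  Vterm (TVert v) (bvec (w, s)) = if w == v then bvec (w, s) else 0.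
Proof.
move=> /bvalidP[p pE]; rewrite -pE bvec_val /= lin_extU /vert_img.
by rewrite /psrc pE.
Qed.

Lemma Vterm_edge e w s : bvalid (w, s) ->
  Vterm (TEdge e) (bvec (w, s)) =
  if rng e == w then bvec (src e, e :: s) else 0.
Proof.
move=> /bvalidP[p pE]; rewrite -pE bvec_val /= lin_extU /edge_img.
by rewrite /psrc /pedges pE.
Qed.

Lemma Vterm_ghost e w s : bvalid (w, s) ->
  Vterm (TGhost e) (bvec (w, s)) =
  if s is f :: s' then if f == e then bvec (rng e, s') else 0 else 0.
Proof.
move=> /bvalidP[p pE]; rewrite -pE bvec_val /= lin_extU /ghost_img.
by rewrite /pedges pE.
Qed.

#[local] Opaque lin_ext vert_img edge_img ghost_img bvec.

Lemma bvalid_cons w e s : bvalid (w, e :: s) -> w = src e /\ bvalid (rng e, s).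
Proof. by move=> [/= /andP[/eqP<- ew] ex]; split=> //; split. Qed.

Lemma bvalid_edge e w s : rng e = w -> bvalid (w, s) -> bvalid (src e, e :: s).
Proof. by move=> <- [ew ex]; split=> //=; rewrite eqxx. Qed.

Hypothesis sx : is_sink x.

Lemma Vterm_sound s t : lrel s t -> Vterm s =1 Vterm t.
Proof.
elim=> {s t}.
- by [].
- by move=> a b _ IH m; rewrite IH.
- by move=> a b c _ IH1 _ IH2 m; rewrite IH1 IH2.
- by move=> a a' b b' _ IH1 _ IH2 m /=; rewrite IH1 IH2.
- by move=> k a a' _ IH m /=; rewrite IH.
- by move=> a a' b b' _ IH1 _ IH2 m /=; rewrite IH2 IH1.
- by move=> a b c m /=; rewrite addrA.
- by move=> a b m /=; rewrite addrC.
- by move=> a m /=; rewrite add0r.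
- by move=> a m /=; rewrite scaleN1r addNr.
- by move=> k l a m /=; rewrite scalerA.
- by move=> a m /=; rewrite scale1r.
- by move=> k a b m /=; rewrite scalerDr.
- by move=> k l a m /=; rewrite scalerDl.
- by [].
- by [].
- by move=> a b c m /=; rewrite linearD.
- by [].
- by move=> k a b m /=; rewrite linearZ.
- move=> v w; apply: Vterm_ext => -[u s] us; rewrite VtermM.
  rewrite (Vterm_vert _ us); case: (eqVneq u w) => [uw|uw]; last first.
    rewrite linear0; case: eqP => [vw|//].
    by rewrite Vterm_vert // vw (negPf uw).
  rewrite Vterm_vert // -uw eq_sym; case: ifP => [uv|//].
  by rewrite Vterm_vert // eq_sym uv.
- move=> e; apply: Vterm_ext => -[u s] us; rewrite VtermM.
  rewrite (Vterm_edge _ us); case: eqP => [eu|_]; last by rewrite linear0.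
  by rewrite Vterm_vert ?eqxx //; apply: bvalid_edge eu us.
- move=> e; apply: Vterm_ext => -[u s] us; rewrite VtermM.
  rewrite (Vterm_vert _ us).
  rewrite (Vterm_edge _ us).
  rewrite [u == _]eq_sym.
  case: eqP => [eu|_]; last by rewrite linear0.
  by rewrite Vterm_edge // eu eqxx.
- move=> e; apply: Vterm_ext => -[u s] us; rewrite VtermM.
  rewrite (Vterm_ghost _ us); case: s us => [|f s] us; first by rewrite linear0.
  have [_ vs] := bvalid_cons us.
  case: eqP => [fe|_]; last by rewrite linear0.
  by rewrite Vterm_vert ?eqxx // -fe.
- move=> e; apply: Vterm_ext => -[u s] us; rewrite VtermM.
  rewrite (Vterm_vert _ us); case: eqP => [//|ue].
  rewrite linear0 (Vterm_ghost _ us); case: s us => [//|f s] us.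
  have [uf _] := bvalid_cons us.
  by case: eqP => // fe; case: ue; rewrite uf fe.
- move=> e f; apply: Vterm_ext => -[u s] us; rewrite VtermM.
  rewrite (Vterm_edge _ us); case: (eqVneq (rng f) u) => [fu|fu].
    rewrite Vterm_ghost; last exact: bvalid_edge fu us.
    rewrite [f == e]eq_sym; case: eqP => [ef|//].
    by rewrite Vterm_vert // -fu ef eqxx.
  rewrite linear0; case: eqP => [ef|//].
  by rewrite Vterm_vert // ef eq_sym (negPf fu).
- move=> v s s0 us sv; apply: Vterm_ext => -[u t] ut.
  rewrite (Vterm_vert _ ut).
  set G := foldr _ _ _.
  have -> : Vterm G (bvec (u, t)) =
      \sum_(e <- s) Vterm (TEdge e) (Vterm (TGhost e) (bvec (u, t))).
    rewrite /G; elim: (s) => [|e s' IH]; first by rewrite big_nil.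
    by rewrite big_cons -IH.
  case: t ut => [|f t] ut.
    have ux : u = x by case: ut.
    rewrite big1_seq.
      case: eqP => // uv; case: s s0 us sv G => // e s _ _ sv _.
      by case: (sx (e := e)); rewrite -ux uv; apply/sv; rewrite mem_head.
    by move=> e _; rewrite (Vterm_ghost _ ut) linear0.
  have [uf vt] := bvalid_cons ut.
  have Hsum e : Vterm (TEdge e) (Vterm (TGhost e) (bvec (u, f :: t))) =
      if f == e then bvec (u, f :: t) else 0.
    rewrite (Vterm_ghost _ ut); case: eqP => [<-|_]; last by rewrite linear0.
    by rewrite (Vterm_edge _ vt) eqxx uf.
  under eq_bigr do rewrite Hsum.
  have [fs|fs] := boolP (f \in s).
    rewrite (bigD1_seq f fs us) /= eqxx uf ((sv f).1 fs) eqxx.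
    by rewrite big1 ?addr0 // => e ef; rewrite eq_sym (negPf ef).
  rewrite big1_seq => [|e /= es].
    by case: eqP => // uv; case/negP: fs; apply/sv; rewrite -uf.
  by case: eqP => // fe; rewrite fe es in fs.
Qed.

Definition Vact (a : leavitt K E) : Vspace -> Vspace := Vterm (repr a).

Lemma Vact_cls t : Vact (cls t) =1 Vterm t.
Proof. by apply: Vterm_sound; exact: repr_cls. Qed.

Lemma Vact_linear a : linear (Vact a).
Proof. exact: Vterm_linear. Qed.

HB.instance Definition _ a :=
  GRing.isLinear.Build K Vspace Vspace *:%R (Vact a) (Vact_linear a).

Lemma Vact_linearl m : linear (Vact^~ m).
Proof.
move=> k; elim/cls_ind=> a; elim/cls_ind=> b.
rewrite [k *: _]lscaleE [_ + _]laddE !Vact_cls //.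
Qed.

Lemma VactA a b m : Vact (lmul a b) m = Vact a (Vact b m).
Proof.
by elim/cls_ind: a => a; elim/cls_ind: b => b; rewrite lmulE !Vact_cls.
Qed.

Lemma Vact_path_raw u t w s : is_walk u t -> bvalid (w, s) ->
  Vact (foldl (fun a e => lmul a (ledge K e)) (lvert K u) t) (bvec (w, s)) =
  if raw_rng (u, t) == w then bvec (u, t ++ s) else 0.
Proof.
rewrite /raw_rng /=.
elim/last_ind: t w s => [|t e IH] w s ut ws.
  by rewrite /= Vact_cls Vterm_vert // eq_sym; case: eqP => // ->.
rewrite foldl_rcons VactA [Vact (ledge K e) _]Vact_cls Vterm_edge //.
have [ut' te] : is_walk u t /\ last u (map (@rng E) t) = src e.
  move: ut {IH}; rewrite -cats1.
  elim: t u => [|f t IHt] u /=; first by rewrite andbT => /eqP.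
  by move=> /andP[-> /IHt].
rewrite map_rcons last_rcons; case: eqP => [ew|_]; last by rewrite linear0.
rewrite IH //; last exact: bvalid_edge ew ws.
by rewrite te eqxx cat_rcons.
Qed.

Lemma bvalid_cat u t s :
  is_walk u t -> bvalid (u, t ++ s) <-> bvalid (raw_rng (u, t), s).
Proof.
elim: t u => [//|e t IH] u /= /andP[/eqP eu et]; rewrite -eu.
have [IH1 IH2] := IH _ et; split.
  by move=> /bvalid_cons[_ /IH1].
by move=> /IH2 H; exact: bvalid_edge H.
Qed.

Lemma Vact_ghost_raw u t w s : is_walk u t -> bvalid (w, s) ->
  Vact (foldl (fun a e => lmul (lghost K e) a) (lvert K u) t) (bvec (w, s)) =
  if (u == w) && prefix t s then bvec (raw_rng (u, t), drop (size t) s) else 0.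
Proof.
move=> + ws; elim/last_ind: t => [|t e IH] ut.
  by rewrite prefix0s andbT drop0 /= Vact_cls Vterm_vert // eq_sym; case: eqP => // ->.
have ut' : is_walk u t.
  move: ut {IH}; rewrite -cats1.
  elim: t u => [|f t IHt] u //=.
  by move=> /andP[-> /IHt].
rewrite foldl_rcons VactA IH // [Vact (lghost K e) _]Vact_cls.
case: eqP => [uw|_]; last by rewrite !andFb linear0.
rewrite !andTb.
case: (boolP (prefix t s)) => [/prefixP[s' sE]|nts]; last first.
  rewrite linear0; case: ifP => // /prefixP[s' sE].
  by case/negP: nts; rewrite sE cat_rcons prefix_prefix.
rewrite sE drop_size_cat // Vterm_ghost; last first.
  by apply/bvalid_cat => //; rewrite -sE uw.
rewrite /raw_rng /= map_rcons last_rcons size_rcons -cats1.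
rewrite prefix_catr //.
case: s' {sE} => [|f s'] /=; rewrite eqxx // prefix0s andbT andTb eq_sym.
by case: eqP => // _; rewrite -cat1s catA drop_size_cat // size_cat addn1.
Qed.

Lemma Vact_mono (mu nu p' : fpath E) (p q : paths_to x) :
  prng mu = prng nu -> pcat_spec nu p' (val p) -> pcat_spec mu p' (val q) ->
  Vact (lmono K mu nu) << p >> = << q >>.
Proof.
move=> mn [np psn pe] [mp qsm qe].
have vp := bvalid_val p; have vq := bvalid_val q.
rewrite -!bvec_val /lmono VactA /lpath /lpath_ghost.
move: vp vq psn qsm pe qe np mp mn; rewrite /prng /psrc /pedges.
case: (pval (val p)) => w s; case: (pval (val q)) => w' s'.
case: mu nu p' => [[u t] ut] [[v r] vr] [[z y] zy] /=.
move=> + + wv wu sr st; rewrite wv {w wv} wu {w' wu} sr {s sr} st {s' st}.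
move=> vp vq np mp mn.
rewrite (Vact_ghost_raw vr vp) eqxx prefix_prefix drop_size_cat // andTb.
rewrite (Vact_path_raw ut); first by rewrite mn eqxx.
exact/bvalid_cat.
Qed.

Lemma Vact_mono0 (mu nu : fpath E) (p : paths_to x) :
  ~ (exists p', pcat_spec nu p' (val p)) -> Vact (lmono K mu nu) << p >> = 0.
Proof.
move=> np; have vp := bvalid_val p.
rewrite -bvec_val /lmono VactA /lpath /lpath_ghost.
move: np vp; rewrite /pcat_spec /prng /psrc /pedges.
case: (pval (val p)) => w s; case: nu => [[v r] vr] /= np vp.
rewrite (Vact_ghost_raw vr vp).
case: eqP => [vw|_]; last by rewrite andFb linear0.
rewrite andTb; case: ifP => [/prefixP[y sE]|_]; last by rewrite linear0.
case: np; rewrite sE -vw in vp *.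
have [yw _] := (bvalid_cat y vr).1 vp.
by exists (@FPath E (raw_rng (v, r), y) yw).
Qed.

Lemma paths_to_cat (mu p : fpath E) : prng mu = psrc p -> prng p = x ->
  exists q : paths_to x, pcat_spec mu p (val q).
Proof.
case: mu p => [[u t] ut] [[z y] zy]; rewrite /prng /psrc /= => tz yx.
have /bvalidP[q qE] : bvalid (u, t ++ y).
  by apply/(bvalid_cat y ut); rewrite tz.
by exists q; rewrite /pcat_spec /prng /psrc /pedges qE.
Qed.

Lemma pcat_len (mu nu p : fpath E) :
  pcat_spec mu nu p -> plen p = (plen mu + plen nu)%N.
Proof. by move=> [_ _ pE]; rewrite /plen pE size_cat. Qed.

Lemma pcat_rng (mu nu p : fpath E) : pcat_spec mu nu p -> prng p = prng nu.
Proof.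
move=> [mn ps pE]; move: mn ps pE; rewrite /prng /raw_rng /psrc /pedges.
by move=> mn -> ->; rewrite map_cat last_cat mn.
Qed.

Lemma Vact_unital m : exists (n : nat) (a : 'I_n -> leavitt K E)
  (y : 'I_n -> Vspace), m = \sum_(i < n) Vact (a i) (y i).
Proof.
pose s : seq (paths_to x) := msupp m.
exists (size s), (fun i => lvert K (psrc (val (tnth (in_tuple s) i)))).
exists (fun i => m@_(tnth (in_tuple s) i) *: << tnth (in_tuple s) i >>).
rewrite {1}(monalgE m) -/s [LHS](big_tnth _ _ s).
apply: eq_bigr => i _; set p := tnth _ i.
rewrite malgUZ linearZ /=; congr (_ *: _).
rewrite -bvec_val [Vact _ _]Vact_cls.
have := bvalid_val p; rewrite /psrc; case: (pval (val p)) => w t wt.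
by rewrite (Vterm_vert _ wt) eqxx.
Qed.

Definition Vmodule : lmodule K E :=
  LModule Vact_linear Vact_linearl VactA Vact_unital.

Definition Vpart (k : int) : set Vspace :=
  [set m | forall p : paths_to x, m@_p != 0 -> (plen (val p))%:Z = k].

Lemma Vpart_sub k : is_subspace (Vpart k).
Proof.
split=> [p|c u w Hu Hw p]; first by rewrite mcoeff0 eqxx.
rewrite mcoeffD mcoeffZ; have [u0|/Hu //] := eqVneq u@_p 0.
by rewrite u0 mulr0 add0r => /Hw.
Qed.

Lemma VpartU k p : (plen (val p))%:Z = k -> Vpart k << p >>.
Proof.
move=> pk q; rewrite mcoeffU.
by have [<-|_] := eqVneq p q; rewrite ?mulr0n ?eqxx.
Qed.

Lemma subspace_sum (W : lmodType K) (U : set W) (I : Type) (r : seq I)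
    (c : I -> K) (f : I -> W) :
  is_subspace U -> (forall i, c i != 0 -> U (f i)) ->
  U (\sum_(i <- r) c i *: f i).
Proof.
move=> [U0 UD] Uf; elim: r => [|i r IH]; first by rewrite big_nil.
rewrite big_cons; have [->|/Uf ci] := eqVneq (c i) 0.
  by rewrite scale0r add0r.
exact: UD.
Qed.

Lemma sum_by_degree (W : lmodType K) (I : eqType) (r : seq I) (deg : I -> int)
    (c : I -> K) (f : I -> W) :
  \sum_(i <- r) c i *: f i =
  \sum_(k <- undup [seq deg i | i <- r])
    \sum_(i <- r) (if deg i == k then c i else 0) *: f i.
Proof.
rewrite exchange_big /= [LHS]big_seq [RHS]big_seq; apply: eq_bigr => i ir.
rewrite -scaler_suml; congr (_ *: _).
rewrite (bigD1_seq (deg i)) ?undup_uniq ?mem_undup ?map_f //= eqxx.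
by rewrite big1 ?addr0 // => k ki; rewrite eq_sym (negPf ki).
Qed.

Lemma Vpart_direct : direct_sum Vpart.
Proof.
split; first exact: Vpart_sub.
- move=> m; pose deg (p : paths_to x) := (plen (val p))%:Z.
  exists (undup [seq deg p | p <- msupp m]).
  exists (fun k => \sum_(p <- msupp m) (if deg p == k then m@_p else 0) *: << p >>).
  split=> [k|].
    apply: subspace_sum; first exact: Vpart_sub.
    by move=> p; case: (deg p =P k) => [pk _|_]; [exact: VpartU|rewrite eqxx].
  by rewrite {1}(malg_basis m); exact: sum_by_degree.
- move=> s f us Hf Hsum k ks; apply/malgP => p; rewrite mcoeff0.
  apply/eqP/negP => /negP fp; case/eqP: (fp).
  have := congr1 (mcoeff p) Hsum; rewrite mcoeff0 raddf_sum /= (bigD1_seq k) //=.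
  rewrite big1 ?addr0 // => j jk; apply/eqP/negP => /negP fj.
  by case/eqP: jk; rewrite -(Hf _ _ fj) (Hf _ _ fp).
Qed.

Lemma Vpart_act (k l : int) a m :
  ldeg k a -> Vpart l m -> Vpart (k + l) (Vact a m).
Proof.
move=> [n [c [mu [nu [Hd ->]]]]] Hm.
have -> : Vact (\sum_(i < n) c i *: lmono K (mu i) (nu i)) m =
    \sum_(i < n) c i *: Vact (lmono K (mu i) (nu i)) m.
  have Hl := Vact_linearl m; elim/big_rec2: _ => [|i y1 y2 _ IH].
    have := Hl (-1) 0 0; rewrite scaler0 addr0.
    by rewrite scaleN1r addNr.
  by rewrite Hl IH.
apply: subspace_sum; first exact: Vpart_sub.
move=> i _; have [mn <-] := Hd i.
rewrite (malg_basis m) linear_sum.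
under eq_bigr do rewrite linearZ.
set k' := _ + l.
apply: (@subspace_sum _ (Vpart k') _ _ (fun p => m@_p)
  (fun p : paths_to x => Vact (lmono K (mu i) (nu i)) << p >>)).
  exact: Vpart_sub.
move=> p /Hm pl.
have [[p' np']|np'] := pselect (exists p', pcat_spec (nu i) p' (val p)); last first.
  by rewrite Vact_mono0 //; have [] := Vpart_sub ((plen (mu i))%:Z - (plen (nu i))%:Z + l).
have [q mq] : exists q : paths_to x, pcat_spec (mu i) p' (val q).
  apply: paths_to_cat; first by rewrite mn; case: np'.
  by rewrite -(pcat_rng np'); apply/eqP; case: (p).
rewrite (Vact_mono mn np' mq); apply: VpartU.
rewrite /k' (pcat_len mq) -pl (pcat_len np') !PoszD.
by rewrite addrA subrK.
Qed.

Definition Vgr : grmodule K E := @GrModule K E Vmodule Vpart Vpart_direct Vpart_act.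

End SinkModule.

(* Main.v *)
(* A nonzero vector of V_[x] has a nonzero coefficient on some path p, and then
   p^* maps it to a multiple of the trivial path at x, which generates V_[x]; so
   V_[x] is simple.  It has finite dimension iff [x] is finite, which for a
   row-finite graph means that x is maximal with finitely many predecessors.

   Conversely, let m be nonzero of lowest degree d in a finite-dimensional graded
   simple module M.  Some vertex v has v m <> 0; if v were not a sink, v m would be
   the sum of the e e^* m, which vanish as the e^* lower the degree.  So v is a
   sink, and p |-> p m is an isomorphism from V_[v](-d) onto M. *)
From HB Require Import structures.
Require Import Defs.
From mathcomp Require Import all_boot all_order all_algebra.
From mathcomp Require Import boolp classical_sets cardinality.
From mathcomp Require Import finmap monalg zify.

Set Implicit Arguments.
Unset Strict Implicit.
Unset Printing Implicit Defensive.

Import Order.TTheory GRing.Theory Num.Theory.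

Local Open Scope classical_set_scope.
Local Open Scope ring_scope.

(** * Walks, cycles, and finiteness of the set of paths ending at a sink *)

Section Walks.
Variable E : digraph.
Implicit Types (v w x : vert E) (s t : seq (edge E)).

Lemma is_walk_cat v s t :
  is_walk v (s ++ t) = is_walk v s && is_walk (raw_rng (v, s)) t.
Proof.
by elim: s v => [//|e s IH] v /=; rewrite IH andbA.
Qed.

Lemma raw_rng_cat v s t : raw_rng (v, s ++ t) = raw_rng (raw_rng (v, s), t).
Proof. by rewrite /raw_rng /= map_cat last_cat. Qed.

Lemma connectsP v w :
  connects v w <-> exists2 s, is_walk v s & raw_rng (v, s) = w.
Proof.
split=> [[[[u s] us] [/= <- <-]]|[s vs <-]]; first by exists s.
by exists (@FPath E (v, s) vs).
Qed.

Lemma connects_cat v s w :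
  is_walk v s -> connects (raw_rng (v, s)) w -> connects v w.
Proof.
move=> vs /connectsP[t wt wE]; apply/connectsP; exists (s ++ t).
  by rewrite is_walk_cat vs wt.
by rewrite raw_rng_cat.
Qed.

Lemma repeated_image (A B : eqType) (f : A -> B) (r : seq A) :
  ~~ uniq (map f r) -> exists r1 a r2 b r3,
    r = r1 ++ (a :: r2) ++ b :: r3 /\ f a = f b.
Proof.
elim: r => [//|a r IH] /=; rewrite negb_and negbK.
case/orP=> [/mapP[b /path.splitPr[r2 r3] ab]|/IH].
  by exists [::], a, r2, b, r3.
by move=> [r1 [c [r2 [b [r3 [-> cb]]]]]]; exists (a :: r1), c, r2, b, r3.
Qed.

(** Cut [s] just before two edges with a common source: [s2] begins with the first and [s3] with the
    second. So both are nonempty and [s2] is a closed walk strictly shorter than [s]. *)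
Lemma repeated_walk v s : is_walk v s -> ~~ uniq (map (@src E) s) ->
  exists s1 s2 s3, [/\ s = s1 ++ s2 ++ s3, s2 != [::], s3 != [::]
    & raw_rng (raw_rng (v, s1), s2) = raw_rng (v, s1)].
Proof.
move=> vs /repeated_image[s1 [e [s2 [f [s3 [sE ef]]]]]].
exists s1, (e :: s2), (f :: s3); split=> //.
move: vs; rewrite sE is_walk_cat is_walk_cat => /and3P[_ /= /andP[/eqP <- _]].
by move=> /andP[/eqP <- _].
Qed.

(* A shortest closed walk is a cycle. *)
Lemma closed_walk_cycle v s w : is_walk v s -> s != [::] ->
  raw_rng (v, s) = v -> connects v w ->
  exists2 c : Defs.fpath E, is_cycle c & connects (psrc c) w.
Proof.
have [n] := ubnP (size s); elim: n v s => // n IH v s sn vs s0 vv vw.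
have [us|nus] := boolP (uniq (map (@src E) s)).
  exists (@FPath E (v, s) vs) => //; split=> //; split; last by rewrite /prng vv.
  by rewrite /plen lt0n size_eq0.
have [s1 [s2 [s3 [sE s20 s30 cl]]]] := repeated_walk vs nus.
move: (vs); rewrite sE !is_walk_cat => /and3P[vs1 vs2 vs3].
(* The closed walk [s2] still leads to [w]: follow [s2], then [s3] back to [v], then the given walk
   to [w]. *)
apply: (IH (raw_rng (v, s1)) s2) => //.
  have : (0 < size s3)%N by rewrite lt0n size_eq0.
  by move: sn; rewrite sE !size_cat; lia.
apply: connects_cat vs2 _; apply: connects_cat vs3 _.
by rewrite -!raw_rng_cat -sE vv.
Qed.

(** A repeated source would cut out a closed walk from which the rest of [s] leads to [x], hence a
    cycle connected to [x]. *)
Lemma maximal_sink_uniq v s x : maximal_sink x ->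
  is_walk v s -> raw_rng (v, s) = x -> uniq (map (@src E) s).
Proof.
move=> [_ cx] vs vx; apply/negPn/negP => nus.
have [s1 [s2 [s3 [sE s20 s30 cl]]]] := repeated_walk vs nus.
move: (vs); rewrite sE !is_walk_cat => /and3P[vs1 vs2 vs3].
have [|c cc] := closed_walk_cycle vs2 s20 cl (w := x); last exact: cx.
apply: connects_cat vs2 _; apply/connectsP; exists s3 => //.
by rewrite -!raw_rng_cat -sE.
Qed.

(** Each turn around the closed walk adds at least one edge. *)
Lemma long_walks v s n : is_walk v s -> s != [::] -> raw_rng (v, s) = v ->
  exists t, [/\ is_walk v t, raw_rng (v, t) = v & (n <= size t)%N].
Proof.
move=> vs s0 vv; elim: n => [|n [t [vt tv nt]]]; first by exists [::].
exists (s ++ t); split; first by rewrite is_walk_cat vs vv.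
  by rewrite raw_rng_cat vv.
have : (0 < size s)%N by rewrite lt0n size_eq0.
by rewrite size_cat; lia.
Qed.

Lemma finite_words (A : choiceType) (D : set A) (n : nat) : finite_set D ->
  finite_set [set r : seq A | (size r <= n)%N /\ forall a, a \in r -> D a].
Proof.
move=> fD; elim: n => [|n IH].
  apply: (sub_finite_set _ (finite_set1 [::])) => r [].
  by rewrite leqn0 size_eq0 => /eqP.
have := finite_image2 cons fD IH; set U := image2 _ _ _ => fU.
have : finite_set ([set [::]] `|` U) by rewrite finite_setU; split.
apply: sub_finite_set.
case=> [_|a r [/= rn rD]]; [by left | right].
exists a; first by apply: rD; rewrite mem_head.
by exists r => //; split=> // b br; apply: rD; rewrite inE br orbT.
Qed.

Lemma walk_sources v s w a : is_walk v s -> connects (raw_rng (v, s)) w ->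
  a \in s -> connects (src a) w.
Proof.
move=> vs vw /path.splitPr sE; case: sE vs vw => s1 s2.
rewrite is_walk_cat => /andP[_ /= /andP[/eqP au as2]] vw.
apply: (@connects_cat (src a) (a :: s2)); first by rewrite /= eqxx.
by move: vw; rewrite raw_rng_cat au.
Qed.

(** The edges of a path to [x] are emitted by predecessors of [x], so by row-finiteness they come
    from a finite set [D]. Their sources are distinct, which bounds the length by the number of
    predecessors. *)
Lemma finite_paths_to x : row_finite E -> maximal_sink x ->
  finite_set (predecessors x) -> finite_set [set: paths_to x].
Proof.
move=> rf mx fx.
pose D := \bigcup_(v in predecessors x) [set e | src e = v].
have fD : finite_set D by apply: bigcup_finite => // v _; exact: rf.
have /finite_seqP[P PE] := fx.
have fW := finite_setX fx (finite_words (size P) fD).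
have := @finite_preimage _ _ _ (fun p : paths_to x => pval (val p)) _ fW.
move=> /(_ (fun p q _ _ pq => val_inj (val_inj pq))).
apply: sub_finite_set => p _.
case: p => -[[v s] /= vs] /eqP vx /=.
have {}vx : raw_rng (v, s) = x := vx.
have xx : connects x x by apply/connectsP; exists [::].
have sD a : a \in s -> predecessors x (src a).
  by move=> /(walk_sources vs); apply; rewrite vx.
split=> /=; first by apply/connectsP; exists s.
split=> [|a /sD ax]; last by exists (src a).
rewrite -(size_map (@src E)); apply: uniq_leq_size.
  exact: maximal_sink_uniq mx vs vx.
by move=> w /mapP[a /sD + ->]; rewrite PE.
Qed.

(** The predecessors are the sources of the paths in [x]. A cycle connected to [x] could be repeated
    to give paths to [x] of unbounded length. *)
Lemma finite_paths_maximal x : is_sink x -> finite_set [set: paths_to x] ->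
  maximal_sink x /\ finite_set (predecessors x).
Proof.
move=> sx fx; split; last first.
  apply: (sub_finite_set _ (finite_image (fun p : paths_to x => psrc (val p)) fx)).
  by move=> w [p [<- px]]; exists (exist _ p (introT eqP px)).
split=> // -[[v s] /= vs] [[/= s0 vv] _] /connectsP[t vt tx].
have /finite_seqP[L LE] := fx.
have [r [vr rv]] : exists r, [/\ is_walk v r, raw_rng (v, r) = v
    & (\max_(p <- L) plen (val p)).+1 <= size r]%N.
  by apply: (@long_walks v s) => //; rewrite -size_eq0 -lt0n.
have vrt : is_walk v (r ++ t) by rewrite is_walk_cat vr rv.
have rtx : prng (@FPath E (v, r ++ t) vrt) == x.
  by rewrite /prng /= raw_rng_cat rv tx.
pose p : paths_to x := exist _ (@FPath E (v, r ++ t) vrt) rtx.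
(* [r] alone is longer than every path listed in [L], yet [p] extends [r] and must be listed. *)
have pL : p \in L by have : [set: paths_to x] p by []; rewrite LE.
have := @leq_bigmax_seq _ L xpredT (fun p : paths_to x => plen (val p)) p pL isT.
by rewrite /plen /= size_cat; lia.
Qed.

End Walks.

(** * Homogeneous components *)

Section DirectSum.
Variables (K : fieldType) (V : lmodType K) (H : int -> set V).
Hypothesis dH : direct_sum H.

Lemma direct_sum_uniq m : exists (s : seq int) (f : int -> V),
  [/\ uniq s, forall k, H k (f k) & m = \sum_(k <- s) f k].
Proof.
have [Hs Hd _] := dH; have [s [f [Hf ->]]] := Hd m.
(* A degree listed several times is kept once, its component being multiplied by the number of
   occurrences. *)
exists (undup s), (fun k => (count_mem k s)%:R *: f k).
split=> [|k|]; first exact: undup_uniq.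
  have [H0 HD] := Hs k.
  by have := HD (count_mem k s)%:R (f k) 0; rewrite addr0; apply.
rewrite -(big_undup_iterop_count _ s xpredT f); apply: eq_bigr => k _.
by rewrite scaler_nat /GRing.natmul; case: (count_mem k s).
Qed.

Lemma direct_sum_homogeneous k m (s : seq int) (f : int -> V) : H k m ->
  uniq s -> (forall j, H j (f j)) -> m = \sum_(j <- s) f j ->
  forall j, (if j \in s then f j else 0) = (if j == k then m else 0).
Proof.
move=> Hm us Hf mE j; have [Hs _ Hi] := dH.
(* [g] is the difference between the given decomposition of [m] and the one with the single
   component [m] in degree [k]; it sums to 0. *)
pose g i := (- (1 : K)) *: (if i == k then m else 0) + (if i \in s then f i else 0).
have Hg i : H i (g i).
  have [H0 HD] := Hs i; apply: HD; last by case: ifP.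
  by case: eqP => [->|].
pose r := undup (k :: s).
have gr : \sum_(i <- r) g i = 0.
  rewrite big_split /= -scaler_sumr -!big_mkcond.
  have -> : \sum_(i <- r | i == k) m = m.
    rewrite (big_rem k) /= ?mem_undup ?mem_head // eqxx.
    rewrite big1_seq ?addr0 // => i /andP[/eqP->].
    by rewrite mem_rem_uniqF ?undup_uniq.
  have -> : \sum_(i <- r | i \in s) f i = m.
    rewrite mE -big_filter; apply: perm_big; apply: uniq_perm => //.
      by rewrite filter_uniq ?undup_uniq.
    by move=> i; rewrite mem_filter mem_undup inE; case: (i \in s); rewrite ?orbT.
  by rewrite scaleN1r addNr.
have [jr|] := boolP (j \in r); last first.
  by rewrite mem_undup inE negb_or => /andP[/negPf-> /negPf->].
have /eqP := Hi r g (undup_uniq _) Hg gr j jr.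
by rewrite /g scaleN1r addrC subr_eq0 => /eqP.
Qed.

(** Only the finitely many degrees occurring in the vectors of a finite spanning family can carry
    nonzero elements. *)
Lemma finite_dim_degrees : finite_dim V ->
  exists s : seq int, forall k m, H k m -> m <> 0 -> k \in s.
Proof.
move=> [n [b bV]].
have [r rP] : {r : 'I_n -> seq int & forall i, exists f : int -> V,
    [/\ uniq (r i), forall k, H k (f k) & b i = \sum_(k <- r i) f k]}.
  by apply: (@choice _ _ (fun i r => exists f : int -> V,
    [/\ uniq r, forall k, H k (f k) & b i = \sum_(k <- r) f k])) => i;
  exact: direct_sum_uniq.
have [f fP] := choice rP.
have [Hs _ _] := dH.
pose s := undup (flatten [seq r i | i <- enum 'I_n]); exists s => k m Hm m0.
have [c mE] := bV m.
(* The component of [m] in degree [j], computed from those of the spanning vectors. *)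
pose g j := \sum_(i < n) c i *: (if j \in r i then f i j else 0).
have Hg j : H j (g j).
  apply: subspace_sum => // i _; case: ifP => _; last by case: (Hs j).
  by case: (fP i).
have mS : m = \sum_(j <- s) g j.
  rewrite exchange_big /= mE; apply: eq_bigr => i _.
  rewrite -scaler_sumr; congr (_ *: _); case: (fP i) => ur _ ->.
  rewrite -big_mkcond -big_filter; apply: perm_big; apply: uniq_perm => //.
    by rewrite filter_uniq ?undup_uniq.
  move=> j; rewrite mem_filter mem_undup; case: (boolP (j \in r i)) => //= jr.
  symmetry; apply/flatten_mapP; exists i => //; exact: mem_enum.
have := direct_sum_homogeneous Hm (undup_uniq _) Hg mS k; rewrite eqxx.
by case: ifP => // _ m0'; case: m0.
Qed.

End DirectSum.

(** * Relations of the algebra read on a module, local units, and degrees of the generators *)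

Section Action.
Variables (K : fieldType) (E : digraph).

HB.instance Definition _ (M : lmodule K E) a :=
  GRing.isLinear.Build K M M *:%R (@lact K E M a) (lact_linear a).

Section Module.
Variable M : lmodule K E.
Implicit Types (m : M) (a b : leavitt K E).

Definition lactl m a : M := lact a m.
HB.instance Definition _ m :=
  GRing.isLinear.Build K (leavitt K E) M *:%R (lactl m) (lact_linearl m).

Lemma lactDl a b m : lact (a + b) m = lact a m + lact b m.
Proof. exact: (linearD (lactl m)). Qed.

Lemma lactZl k a m : lact (k *: a) m = k *: lact a m.
Proof. exact: (linearZ_LR (lactl m)). Qed.

Lemma lact0l m : lact 0 m = 0.
Proof. exact: (linear0 (lactl m)). Qed.

Lemma lact_vert v w m :
  lact (lvert K v) (lact (lvert K w) m) =
  if v == w then lact (lvert K v) m else 0.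
Proof.
rewrite -lactA lmulE ((clsP _ _).1 (lrel_vert K v w)).
by case: ifP => // _; exact: lact0l.
Qed.

Lemma lact_src_edge e m :
  lact (lvert K (src e)) (lact (ledge K e) m) = lact (ledge K e) m.
Proof. by rewrite -lactA lmulE ((clsP _ _).1 (lrel_src_edge K e)). Qed.

Lemma lact_edge_rng e m :
  lact (ledge K e) (lact (lvert K (rng e)) m) = lact (ledge K e) m.
Proof. by rewrite -lactA lmulE ((clsP _ _).1 (lrel_edge_rng K e)). Qed.

Lemma lact_rng_ghost e m :
  lact (lvert K (rng e)) (lact (lghost K e) m) = lact (lghost K e) m.
Proof. by rewrite -lactA lmulE ((clsP _ _).1 (lrel_rng_ghost K e)). Qed.

Lemma lact_ghost_src e m :
  lact (lghost K e) (lact (lvert K (src e)) m) = lact (lghost K e) m.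
Proof. by rewrite -lactA lmulE ((clsP _ _).1 (lrel_ghost_src K e)). Qed.

Lemma lact_ghost_edge e f m : lact (lghost K e) (lact (ledge K f) m) =
  if e == f then lact (lvert K (rng e)) m else 0.
Proof.
rewrite -lactA lmulE ((clsP _ _).1 (lrel_ghost_edge K e f)).
by case: ifP => // _; exact: lact0l.
Qed.

Lemma lact_regular v (s : seq (edge E)) m :
  s <> [::] -> uniq s -> (forall e, e \in s <-> src e = v) ->
  lact (lvert K v) m = \sum_(e <- s) lact (ledge K e) (lact (lghost K e) m).
Proof.
move=> s0 us sv; rewrite /lvert ((clsP _ _).1 (lrel_regular K s0 us sv)).
elim: s {s0 us sv} => [|e s IH] /=; first by rewrite big_nil; exact: lact0l.
by rewrite big_cons -laddE lactDl IH -lmulE lactA.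
Qed.

(** Finite sums of distinct vertices are local units. Allowing every [s] that contains [r] makes one
    [s] serve several terms at once; a product needs only the vertices of its left factor. *)
Lemma local_unit_term (t : lterm K E) : exists r : seq (vert E),
  forall s, uniq s -> {subset r <= s} -> forall m,
  \sum_(v <- s) lact (lvert K v) (lact (cls t) m) = lact (cls t) m.
Proof.
have one (v : vert E) a : (forall m, lact (lvert K v) (lact a m) = lact a m) ->
    exists r : seq (vert E), forall s, uniq s -> {subset r <= s} -> forall m,
    \sum_(w <- s) lact (lvert K w) (lact a m) = lact a m.
  move=> va; exists [:: v] => s us vs m; rewrite (bigD1_seq v) //=; last first.
    by apply: vs; rewrite mem_head.
  rewrite va big1 ?addr0 // => w wv.
  by rewrite -(va m) lact_vert (negPf wv).
elim: t => [v|e|e||a [r IHa] b [r' IHb]|k a [r IH]|a [r IH] b _].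
- by apply: (one v) => m; rewrite lact_vert eqxx.
- by apply: (one (src e)) => m; exact: lact_src_edge.
- by apply: (one (rng e)) => m; exact: lact_rng_ghost.
- by exists [::] => s _ _ m; rewrite lact0l big1 // => v _; exact: linear0.
- exists (r ++ r') => s us rs m; rewrite -laddE lactDl.
  rewrite -{2}(IHa s) //; last by move=> v vr; apply: rs; rewrite mem_cat vr.
  rewrite -{2}(IHb s) //; last by move=> v vr; apply: rs; rewrite mem_cat vr orbT.
  by rewrite -big_split; apply: eq_bigr => v _; exact: linearD.
- exists r => s us rs m; rewrite -lscaleE lactZl -{2}(IH s) // scaler_sumr.
  by apply: eq_bigr => v _; exact: linearZ.
- by exists r => s us rs m; rewrite -lmulE lactA IH.
Qed.

(** As the module is unital, [m] is a finite sum of elements a y, so a local unit common to these a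
    fixes [m]; this writes [m] as a sum of elements v m. *)
Lemma lact_faithful m : (forall v, lact (lvert K v) m = 0) -> m = 0.
Proof.
move=> m0; have [n [a [y mE]]] := lact_unital m.
have [r rP] := choice (fun i => local_unit_term (repr (a i))).
pose s := undup (flatten [seq r i | i <- enum 'I_n]).
suff <- : \sum_(v <- s) lact (lvert K v) m = m by apply: big1.
rewrite {2}mE (eq_bigr (fun v => \sum_(i < n) lact (lvert K v) (lact (a i) (y i)))).
  rewrite exchange_big; apply: eq_bigr => i _; rewrite -(cls_repr (a i)).
  apply: rP (undup_uniq _) _ _ => v vr; rewrite mem_undup.
  by apply/flatten_mapP; exists i => //; exact: mem_enum.
by move=> v _; rewrite {1}mE linear_sum.
Qed.

End Module.

Definition vert_path (v : vert E) : Defs.fpath E := @FPath E (v, [::]) isT.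

Lemma edge_walk (e : edge E) : is_walk (src e) [:: e].
Proof. by rewrite /= eqxx. Qed.
Definition edge_path (e : edge E) : Defs.fpath E :=
  @FPath E (src e, [:: e]) (edge_walk e).

Lemma ldeg_mono (mu nu : Defs.fpath E) : prng mu = prng nu ->
  ldeg ((plen mu)%:Z - (plen nu)%:Z) (lmono K mu nu).
Proof.
move=> mn; exists 1%N, (fun=> 1), (fun=> mu), (fun=> nu).
by rewrite big_ord1 scale1r.
Qed.

Lemma ldeg_vert (v : vert E) : ldeg 0 (lvert K v).
Proof.
have -> : lvert K v = lmono K (vert_path v) (vert_path v).
  rewrite /lmono /lpath /lpath_ghost /= lmulE /lvert; symmetry; apply/clsP.
  by have := lrel_vert K v v; rewrite eqxx.
exact: (@ldeg_mono (vert_path v) (vert_path v) erefl).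
Qed.

Lemma ldeg_edge (e : edge E) : ldeg 1 (ledge K e).
Proof.
have -> : ledge K e = lmono K (edge_path e) (vert_path (rng e)).
  rewrite /lmono /lpath /lpath_ghost /= [lmul (lvert K _) (ledge K e)]lmulE.
  rewrite ((clsP _ _).1 (lrel_src_edge K e)) lmulE.
  exact/esym/clsP/lrel_edge_rng.
exact: (@ldeg_mono (edge_path e) (vert_path (rng e)) erefl).
Qed.

Lemma ldeg_ghost (e : edge E) : ldeg (-1) (lghost K e).
Proof.
have -> : lghost K e = lmono K (vert_path (rng e)) (edge_path e).
  rewrite /lmono /lpath /lpath_ghost /= [lmul (lghost K e) _]lmulE.
  rewrite ((clsP _ _).1 (lrel_ghost_src K e)) lmulE.
  exact/esym/clsP/lrel_rng_ghost.
exact: (@ldeg_mono (vert_path (rng e)) (edge_path e) erefl).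
Qed.

End Action.

(** * Transport along linear and graded isomorphisms *)

Section Isomorphisms.
Variables (K : fieldType) (E : digraph).

(** Degrees are only required to be preserved in one direction. For the inverse, decompose [g m],
    apply [f], and compare with the homogeneous element [m] by uniqueness of components. *)
Lemma gr_isomorphic_sym (M N : grmodule K E) :
  gr_isomorphic M N -> gr_isomorphic N M.
Proof.
move=> [f [flin [g fK gK] fa fgr]].
have glin : linear g by move=> k u v; apply: (can_inj fK); rewrite gK flin !gK.
exists g; split=> //; first by exists f.
  by move=> a m; apply: (can_inj fK); rewrite fa !gK.
move=> k m Hm.
have [s [h [us Hh gmE]]] := direct_sum_uniq (gr_direct M) (g m).
pose f' : {linear M -> N} := HB.pack f (GRing.isLinear.Build K M N *:%R f flin).
have mE : m = \sum_(j <- s) f (h j).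
  by rewrite -[LHS]gK gmE [LHS](linear_sum f').
have H := direct_sum_homogeneous (gr_direct N) Hm us (fun j => fgr _ _ (Hh j)) mE.
(* By injectivity of [f], the components of [g m] in degrees other than [k] vanish. *)
suff -> : g m = if k \in s then h k else 0.
  by case: ifP => _ //; have [/(_ k)[]] := gr_direct M.
rewrite gmE; case: ifP => ks.
  rewrite (bigD1_seq k) //= big1_seq ?addr0 // => j /andP[jk js].
  apply: (can_inj fK); have := H j; rewrite js (negPf jk) => ->.
  by rewrite [RHS](linear0 f').
rewrite big1_seq // => j /= js; apply: (can_inj fK).
have := H j; rewrite js [f 0](linear0 f').
by case: eqP => [jk|//]; rewrite -jk js in ks.
Qed.

Lemma finite_dim_iso (V W : lmodType K) (f : V -> W) :
  linear f -> bijective f -> finite_dim V -> finite_dim W.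
Proof.
move=> flin [g fK gK] [n [b bV]]; exists n, (f \o b) => m.
have [c gm] := bV (g m); exists c.
pose f' : {linear V -> W} := HB.pack f (GRing.isLinear.Build K V W *:%R f flin).
rewrite -[LHS]gK gm [LHS](linear_sum f'); apply: eq_bigr => i _.
exact: (linearZ_LR f').
Qed.

Lemma malg_linear_ext (B : choiceType) (W : lmodType K) (f g : {malg K[B]} -> W) :
  linear f -> linear g -> (forall b, f << b >> = g << b >>) -> f =1 g.
Proof.
move=> flin glin fg m.
pose f' : {linear {malg K[B]} -> W} :=
  HB.pack f (GRing.isLinear.Build K {malg K[B]} W *:%R f flin).
pose g' : {linear {malg K[B]} -> W} :=
  HB.pack g (GRing.isLinear.Build K {malg K[B]} W *:%R g glin).
rewrite (malg_basis m) [LHS](linear_sum f') [RHS](linear_sum g').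
apply: eq_bigr => b _.
by rewrite [LHS](linearZ_LR f') [RHS](linearZ_LR g') /= fg.
Qed.

End Isomorphisms.

(** * Dimension and simplicity of V_[x], and its maps to other modules *)

Section SinkModule.
Variables (K : fieldType) (E : digraph) (x : vert E).
Local Notation V := ({malg K[paths_to x]} : lmodType K).

Definition sink_path : paths_to x :=
  exist _ (vert_path x) (eqxx x : prng (vert_path x) == x).

Lemma finite_dim_paths : finite_dim V <-> finite_set [set: paths_to x].
Proof.
split=> [[n [b bV]]|/finite_fsetP[X XE]].
  apply/finite_seqP; exists (flatten [seq (msupp (b i) : seq _) | i <- enum 'I_n]).
  apply/seteqP; split=> // p _ /=.
  have [c pE] := bV << p >>; apply/flatten_mapP.
  (* The basis vector of [p] has coefficient 1 at [p], so some spanning vector has [p] in its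
     support. *)
  have [i pi] : exists i, (b i)@_p != 0.
    apply: contrapT => npi; have /eqP := congr1 (mcoeff p) pE.
    rewrite mcoeffUU raddf_sum /= big1 ?oner_eq0 // => i _.
    rewrite mcoeffZ; have [->|bi] := eqVneq (b i)@_p 0; first by rewrite mulr0.
    by case: npi; exists i.
  by exists i; rewrite ?mem_enum // mcoeff_neq0 in pi *.
pose r : seq (paths_to x) := X.
exists (size r), (fun i => << tnth (in_tuple r) i >>) => m.
exists (fun i => m@_(tnth (in_tuple r) i)).
rewrite -(big_tnth _ _ r xpredT (fun p => m@_p *: << p >>)) [LHS]malg_basis.
apply: (lin_extEw (fun p => << p >> : V)); apply/fsubsetP => p _.
by have : [set: paths_to x] p by []; rewrite XE.
Qed.

Hypothesis sx : is_sink x.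
Local Notation VV := (Vmodule K sx).

(** The ghost of [p] reads off the coefficient at [p]: it kills every other basis path, because only
    [p] itself in [x] has [p] as an initial segment. *)
Lemma lact_sink_path (p : paths_to x) (m : V) :
  lact (lmono K (val sink_path) (val p)) (m : VV) = m@_p *: << sink_path >>.
Proof.
have px : prng (val p) = x by apply/eqP; case: (p).
rewrite {1}[m]malg_basis linear_sum.
have act q : lact (lmono K (val sink_path) (val p)) (<< q >> : VV) =
    if q == p then << sink_path >> else 0.
  case: eqP => [->|qp].
    apply: (Vact_mono K sx (p' := val sink_path)) => //.
      by split; rewrite ?cats0.
  apply: (Vact_mono0 K sx) => -[p' [pp' qp' qe]]; case: qp.
  apply: val_inj; apply: val_inj; rewrite [LHS]surjective_pairing.
  rewrite [RHS]surjective_pairing; congr pair; first exact: qp'.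
  (* [p'] starts at the range of [p], which is the sink [x], so it has no edges. *)
  move: qe; rewrite /pedges => ->; suff -> : (val p').2 = [::] by rewrite cats0.
  have := valP p'; rewrite -/(psrc p') -pp' px.
  by case: ((val p').2) => //= e s /andP[/eqP/sx].
rewrite (eq_bigr (fun q => if q == p then m@_p *: << sink_path >> else 0));
  last first.
  move=> q _; rewrite linearZ.
  transitivity (m@_q *: (if q == p then << sink_path >> else 0 : V)).
    by congr (_ *: _); exact: act.
  by case: eqP => [->|]; rewrite ?scaler0.
rewrite -big_mkcond; have [pm|pm] := boolP (p \in msupp m).
  rewrite (big_rem p) //= eqxx big1_seq ?addr0 // => q /andP[/eqP->].
  by rewrite mem_rem_uniqF ?fset_uniq.
by rewrite mcoeff_outdom // scale0r big1_seq // => q /andP[/eqP->].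
Qed.

Lemma lact_path_sink (p : paths_to x) :
  lact (lmono K (val p) (val sink_path)) (<< sink_path >> : VV) = << p >>.
Proof.
have px : prng (val p) = x by apply/eqP; case: (p).
apply: (Vact_mono K sx (p' := val sink_path)) => //.
by split; rewrite ?cats0.
Qed.

(** Stated for arbitrary submodules, so that it applies directly to the kernel of a homomorphism and
    to the image of a submodule under an isomorphism. *)
Lemma sink_module_simple (N : set VV) m :
  is_submodule N -> N m -> m <> 0 -> N = setT.
Proof.
move=> [sN aN] Nm m0.
have [p mp] : exists p : paths_to x, (m : V)@_p != 0.
  apply: contrapT => np; apply: m0; apply/malgP => p.
  by rewrite mcoeff0; apply/eqP/negPn/negP => mp; apply: np; exists p.
have Nx : N << sink_path >>.
  have := aN (lmono K (val sink_path) (val p)) m Nm.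
  move=> /(sN.2 ((m : V)@_p)^-1 _ 0) /(_ sN.1).
  by rewrite lact_sink_path addr0 scalerA mulVf // scale1r.
apply/seteqP; split=> // v _; rewrite [v]malg_basis.
by apply: subspace_sum sN _ => q _; rewrite -lact_path_sink; exact: aN.
Qed.

(** * The homomorphism from V_[x] sending each path p to p m0 *)

Section Hom.
Variables (M : grmodule K E) (d : int) (m0 : M).
Hypothesis m0d : gr_part d m0.
Hypothesis m0x : lact (lvert K x) m0 = m0.

Definition path_act (s : seq (edge E)) : M :=
  foldr (fun e y => lact (ledge K e) y) m0 s.

Definition sink_hom : V -> M :=
  lin_ext (fun p : paths_to x => path_act (pedges (val p))).

HB.instance Definition _ :=
  GRing.isLinear.Build K V M *:%R sink_hom (lin_ext_linear _).

Lemma sink_homE w s :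
  bvalid x (w, s) -> sink_hom (bvec K x (w, s)) = path_act s.
Proof.
by move=> /bvalidP[p pE]; rewrite -pE bvec_val [LHS]lin_extU /pedges pE.
Qed.

Lemma path_act_vert v w s : bvalid x (w, s) ->
  lact (lvert K v) (path_act s) = if w == v then path_act s else 0.
Proof.
case: s => [|e s] ws.
  have -> : w = x by case: ws.
  by rewrite /= -{1}m0x lact_vert eq_sym; case: eqP => // <-.
have [-> _] := bvalid_cons ws.
rewrite /= -{1}lact_src_edge lact_vert eq_sym; case: eqP => // <-.
exact: lact_src_edge.
Qed.

Lemma path_act_edge e w s : bvalid x (w, s) ->
  lact (ledge K e) (path_act s) = if rng e == w then path_act (e :: s) else 0.
Proof.
move=> ws; rewrite -lact_edge_rng (path_act_vert _ ws) eq_sym.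
by case: eqP => // _; rewrite linear0.
Qed.

Lemma path_act_ghost e w s : bvalid x (w, s) ->
  lact (lghost K e) (path_act s) =
  if s is f :: s' then if f == e then path_act s' else 0 else 0.
Proof.
case: s => [|f s] ws.
  (* On the trivial path, e^* m0 = e^* s(e) x m0, which is 0 since the sink [x] is not the source of
     [e]. *)
  rewrite /= -lact_ghost_src -[m0]m0x lact_vert.
  by case: eqP => [/sx|_] //; rewrite linear0.
have [_ fs] := bvalid_cons ws.
rewrite /= lact_ghost_edge eq_sym; case: eqP => // ef.
by rewrite (path_act_vert _ fs) ef eqxx.
Qed.

(** Induction on an expression for [a]; the generators are compared on basis paths, where both sides
    obey the same rules. *)
Lemma sink_hom_lact a (v : VV) : sink_hom (lact a v) = lact a (sink_hom v).
Proof.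
elim/cls_ind: a => t; rewrite [lact _ v](Vact_cls sx).
have ext (f : {linear V -> V}) a : (forall q, bvalid x q ->
    sink_hom (f (bvec K x q)) = lact a (sink_hom (bvec K x q))) ->
    forall u, sink_hom (f u) = lact a (sink_hom u).
  move=> fa; apply: malg_linear_ext => [k u w|k u w|p]; rewrite ?linearP //.
  by rewrite -bvec_val fa //; exact: bvalid_val.
elim: t v => [u|e|e||a IHa b IHb|k a IH|a IHa b IHb].
- apply: (ext (Vterm (x := x) (TVert u))) => -[w s] ws /=.
  rewrite [lin_ext _ _](Vterm_vert _ _ ws).
  rewrite sink_homE // (path_act_vert _ ws).
  by case: eqP => _; rewrite ?linear0 // sink_homE.
- apply: (ext (Vterm (x := x) (TEdge e))) => -[w s] ws.
  rewrite /= [lin_ext _ _](Vterm_edge _ _ ws) (sink_homE ws) (path_act_edge _ ws).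
  by case: eqP => ew; rewrite ?linear0 // sink_homE //; exact: bvalid_edge ew ws.
- apply: (ext (Vterm (x := x) (TGhost e))) => -[w s] ws.
  rewrite /= [lin_ext _ _](Vterm_ghost _ _ ws) (sink_homE ws) (path_act_ghost _ ws).
  case: s ws => [|f s] ws; first by rewrite linear0.
  have [_ vs] := bvalid_cons ws.
  by case: eqP => [<-|_]; rewrite ?linear0 // sink_homE.
- by move=> u; rewrite [RHS]lact0l; exact: (linear0 sink_hom).
- by move=> u; rewrite -laddE [RHS]lactDl -IHa -IHb; exact: (linearD sink_hom).
- by move=> u; rewrite -lscaleE [RHS]lactZl -IH; exact: (linearZ_LR sink_hom).
- by move=> u; rewrite -lmulE lactA -IHb -IHa.
Qed.

Lemma path_act_part s : gr_part ((size s)%:Z + d) (path_act s).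
Proof.
elim: s => [|e s IH] /=; first by rewrite add0r.
by rewrite -add1n PoszD -addrA; apply: gr_act (ldeg_edge K e) IH.
Qed.

Lemma sink_hom_part k v : gr_part (k - d) (v : Vgr K sx) -> gr_part k (sink_hom v).
Proof.
move=> Hv; have [/(_ k) sk _ _] := gr_direct M.
apply: subspace_sum sk _ => p /Hv pk.
by rewrite -[k](subrK d) -pk; exact: path_act_part.
Qed.

Hypothesis M_simple : graded_simple M.
Hypothesis m0_neq0 : m0 <> 0.

(** The kernel misses the trivial path, which is sent to [m0], so simplicity of V_[x] makes it
    zero. *)
Lemma sink_hom_inj : injective sink_hom.
Proof.
have sub0 : is_submodule [set v : VV | sink_hom v = 0].
  split; first split=> [|k u w]; rewrite /= ?linear0 //.
    move=> u0 w0; transitivity (k *: sink_hom u + sink_hom w).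
      exact: (linearP sink_hom).
    by rewrite u0 w0 scaler0 addr0.
  by move=> a v /= v0; rewrite sink_hom_lact v0 linear0.
have xN : sink_hom << sink_path >> <> 0 by rewrite [sink_hom _]lin_extU.
move=> u v uv; apply: contrapT => /eqP; rewrite -subr_eq0 => /eqP uv0.
have Nuv : sink_hom (u - v) = 0 by rewrite linearB /= uv subrr.
have := sink_module_simple sub0 Nuv uv0.
by move/seteqP => [_ /(_ << sink_path >> I)].
Qed.

(** The image is a graded submodule containing the nonzero vector [m0], hence everything. *)
Lemma sink_hom_surj m : exists v, sink_hom v = m.
Proof.
have gsub : is_graded_submodule (range sink_hom).
  split.
    split; first split=> [|k _ _ [u _ <-] [w _ <-]].
    - by exists 0 => //; exact: linear0.
    - by exists (k *: u + w) => //; exact: linearP.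
    - by move=> a _ [v _ <-]; exists (lact a (v : VV)) => //; exact: sink_hom_lact.
  move=> _ [v _ <-].
  (* Decomposing [v] in the shifted grading puts the image of its component of index [k] in degree
     [k]. *)
  have [_ /(_ v)[s [f [Hf ->]]] _] := gr_direct (grshift (Vgr K sx) (- d)).
  exists s, (sink_hom \o f); split; last exact: linear_sum.
  by move=> k; split; [exists (f k) | apply: sink_hom_part; exact: Hf].
have [/seteqP[/(_ m0) N0 _]|/seteqP[_ /(_ m I)[v _ <-]]] := M_simple.2 _ gsub.
  by case: m0_neq0; apply: N0; exists << sink_path >> => //; exact: lin_extU.
by exists v.
Qed.

Lemma sink_module_iso : gr_isomorphic M (grshift (Vgr K sx) (- d)).
Proof.
apply: gr_isomorphic_sym; exists sink_hom; split.
- exact: linearP.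
- have [g gP] := choice sink_hom_surj.
  by exists g => // v; apply: sink_hom_inj; rewrite gP.
- exact: sink_hom_lact.
- exact: sink_hom_part.
Qed.

End Hom.
End SinkModule.

(** * Lowest degrees and the classification *)

Section Main.
Variables (K : fieldType) (E : digraph).
Implicit Type M : grmodule K E.

(** Otherwise one could descend forever through nonzero homogeneous elements, while only finitely
    many degrees are nonzero. Vanishing one degree below is what the ghost edges, of degree -1, call
    for. *)
Lemma lowest_degree M : graded_simple M -> finite_dim M ->
  exists k (m : M), [/\ gr_part k m, m <> 0
    & forall y : M, gr_part (k - 1) y -> y = 0].
Proof.
move=> [[m m0] _] /(finite_dim_degrees (gr_direct M))[s sP].
apply: contrapT => nlow.
have down k (y : M) : gr_part k y -> y <> 0 ->
    exists2 z : M, gr_part (k - 1) z & z <> 0.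
  move=> ky y0; apply: contrapT => nz; apply: nlow; exists k, y; split=> // z kz.
  by apply: contrapT => z0; apply: nz; exists z.
have [r [f [ur Hf mE]]] := direct_sum_uniq (gr_direct M) m.
have [k fk] : exists k, f k <> 0.
  apply: contrapT => nf; apply: m0; rewrite mE big1 // => k _.
  by apply: contrapT => fk; apply: nf; exists k.
have downs (n : nat) : exists2 z : M, gr_part (k - n%:Z) z & z <> 0.
  elim: n => [|n [z kz z0]]; first by exists (f k) => //; rewrite subr0; exact: Hf.
  have [y ky y0] := down _ _ kz z0; exists y => //.
  by rewrite -addn1 PoszD opprD addrA.
(* These are [size s] + 1 distinct degrees, all forced to lie in [s]. *)
suff : (size [seq (k - n%:Z)%R | n <- iota 0 (size s).+1] <= size s)%N.
  by rewrite size_map size_iota ltnn.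
apply: uniq_leq_size => [|_ /mapP[n _ ->]].
  by rewrite map_inj_uniq ?iota_uniq // => i j /addrI/oppr_inj[].
by have [z kz z0] := downs n; exact: sP kz z0.
Qed.

Lemma sink_of_lowest_degree M k (m : M) v : row_finite E -> gr_part k m ->
  (forall y : M, gr_part (k - 1) y -> y = 0) ->
  lact (lvert K v) m <> 0 -> is_sink v.
Proof.
move=> rf Hm low vm e ev; apply: vm.
have /finite_seqP[r rE] := rf v.
have rP f : f \in undup r <-> src f = v.
  rewrite mem_undup; suff -> : (src f = v) = (f \in r) by [].
  by rewrite -[LHS]/([set f | src f = v] f) rE.
rewrite (lact_regular m _ (undup_uniq r) rP).
  rewrite big1 // => f _.
  have := gr_act (ldeg_ghost K f) Hm; rewrite addrC => /low ->.
  exact: linear0.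
(* The edge [e] makes the list nonempty, as the relation at a regular vertex demands. *)
by move=> r0; have := (rP e).2 ev; rewrite r0.
Qed.

End Main.

Theorem corollary4p25 (K : fieldType) (E : digraph) (hE : row_finite E)
    (M : grmodule K E) :
  (graded_simple M /\ finite_dim M) <->
  exists (x : vert E) (sx : is_sink x) (n : int),
    [/\ maximal_sink x, finite_set (predecessors x)
      & gr_isomorphic M (grshift (Vgr K sx) n)].
Proof.
split=> [[Ms Mf]|[x [sx [n [mx fx iso]]]]].
  have [k [m [km m0 low]]] := lowest_degree Ms Mf.
  have [x xm] : exists x, lact (lvert K x) m <> 0.
    apply: contrapT => nx; apply/m0/lact_faithful => x.
    by apply: contrapT => xm; apply: nx; exists x.
  have sx := sink_of_lowest_degree hE km low xm.
  (* The vector x m can serve as [m0]: it is nonzero, fixed by [x], and still of degree [k] since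
     vertices have degree 0. *)
  have kxm : gr_part k (lact (lvert K x) m).
    by have := gr_act (ldeg_vert K x) km; rewrite add0r.
  have xxm : lact (lvert K x) (lact (lvert K x) m) = lact (lvert K x) m.
    by rewrite lact_vert eqxx.
  have iso := sink_module_iso sx kxm xxm Ms xm.
  have [f [flin fbij _ _]] := iso.
  have Vf := finite_dim_iso flin fbij Mf.
  have [mx fx] := finite_paths_maximal sx ((finite_dim_paths K x).1 Vf).
  by exists x, sx, (- k).
have [f [flin fbij fa _]] := iso.
split; last first.
  have [g [glin gbij _ _]] := gr_isomorphic_sym iso.
  apply: finite_dim_iso glin gbij _.
  by apply/finite_dim_paths; exact: finite_paths_to.
have [g fK gK] := fbij.
have f0 : f 0 = 0.
  by have := flin (-1) 0 0; rewrite !scaleN1r !addNr.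
split.
  exists (g << sink_path x >>) => g0.
  have /malgP/(_ (sink_path x)) := gK << sink_path x >>.
  by rewrite g0 f0 mcoeff0 mcoeffUU => /esym/eqP; rewrite oner_eq0.
move=> N [[[N0 ND] Na] _].
have [[m Nm m0]|N_0] := pselect (exists2 m, N m & m <> 0); [right|left]; last first.
  apply/seteqP; split=> [m Nm|_ ->//].
  by apply: contrapT => m0; apply: N_0; exists m.
(* Simplicity is transported by [f]: the image of [N] is a nonzero submodule of V_[x], hence all of
   it, and injectivity of [f] returns to [N]. *)
have sfN : @is_submodule K E (Vmodule K sx) [set f y | y in N].
  split; last by move=> a _ [y Ny <-]; exists (lact a y); [exact: Na | exact: fa].
  split; first by exists 0.
  move=> k _ _ [y Ny <-] [z Nz <-]; exists (k *: y + z); first exact: ND.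
  exact: flin.
have fm0 : f m <> 0 by rewrite -f0 => /(can_inj fK).
have fNT := sink_module_simple sfN (ex_intro2 _ _ _ Nm erefl) fm0.
apply/seteqP; split=> // y _.
have : [set f y | y in N] (f y) by rewrite fNT.
by move=> [z Nz /(can_inj fK) <-].
Qed.
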